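(* Let $(a_n)_{n \in \mathbb{N}}$ be a sequence of distinct positive integers, and for $N \geq 1$ let $A_N = \{a_1, \ldots, a_N\}$. If $E(A_N) = \Omega(N^3)$, then for every real number $\alpha$ the sequence $(\{a_n \alpha\})_{n \in \mathbb{N}}$ does not have Poissonian pair correlations.
   Context: For a finite set $A$ of reals, the additive energy is $E(A) = \#\{(a,b,c,d) \in A^4 : a+b = c+d\}$. The notation $E(A_N) = \Omega(N^3)$ means that there is a constant $\kappa > 0$ with $E(A_N) \geq \kappa N^3$ for infinitely many $N$ (i.e. $\limsup_{N\to\infty} E(A_N)/N^3 > 0$). $\{x\}$ denotes the fractional part of $x$ and $\|x\|$ the distance from $x$ to the nearest integer. A sequence $(x_n)_{n\in\mathbb{N}}$ in $[0,1)$ has (asymptotically) Poissonian pair correlations if for every $s > 0$, $$R_2([-s,s],(x_n),N) := \frac{1}{N}\#\left\{1 \leq i \neq j \leq N : \|x_i - x_j\| \leq \frac{s}{N}\right\} \to 2s \quad (N \to \infty).$$ *)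

(* Defs.v *)
From HB Require Import structures.
From mathcomp Require Import all_boot all_order all_algebra.
From mathcomp Require Import all_classical all_reals all_analysis.
Set Implicit Arguments. Unset Strict Implicit. Unset Printing Implicit Defensive.
Import Order.TTheory GRing.Theory Num.Theory numFieldNormedType.Exports.
Local Open Scope ring_scope.
Local Open Scope classical_set_scope.

Definition additive_energy (A : seq nat) : nat :=
  let B := undup A in
  \sum_(a <- B) \sum_(b <- B) \sum_(c <- B) \sum_(d <- B) ((a + b == c + d) : nat).

Definition A_N (a : nat -> nat) (N : nat) : seq nat := [seq a i | i <- index_iota 1 N.+1].

Definition energy_Omega_cube (R : realType) (a : nat -> nat) : Prop :=
  exists kappa : R, 0 < kappa /\
    forall M : nat, exists N : nat, (M <= N)%N /\
      kappa * (N%:R) ^+ 3 <= (additive_energy (A_N a N))%:R.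

Definition fracpart (R : realType) (x : R) : R := x - (Num.floor x)%:~R.

Definition dist_nearest_int (R : realType) (x : R) : R :=
  Num.min (fracpart x) (1 - fracpart x).

(* R_2([-s,s], (x_n), N) with x indexed from 1 *)
Definition R2 (R : realType) (x : nat -> R) (s : R) (N : nat) : R :=
  (N%:R)^-1 *
  (#|[set ij : 'I_N.+1 * 'I_N.+1 |
       [&& (0 < ij.1)%N, (0 < ij.2)%N, ij.1 != ij.2 &
           dist_nearest_int (x ij.1 - x ij.2) <= s / N%:R]]|)%:R.

Definition poissonian_pair_correlations (R : realType) (x : nat -> R) : Prop :=
  forall s : R, 0 < s -> (R2 x s @ \oo --> (2 * s)%R)%classic.

(* Main.v *)
Require Import Defs.
From HB Require Import structures.
From mathcomp Require Import all_boot all_order all_algebra.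
From mathcomp Require Import all_classical all_reals all_analysis.
From mathcomp Require Import zify lra ring.
Import Order.TTheory GRing.Theory Num.Theory.
Local Open Scope ring_scope.

(** For a difference [v], let [r v] count the pairs of indices [<= N] with
    difference [v], so that the energy is the sum of [r v ^ 2].  Cut the circle
    into about [N / K] arcs.  Applying Cauchy-Schwarz to the pairs of each fixed
    difference, classified by the arc containing the first point, and then
    exchanging the roles of the two parallelogram sides, gives
    [E <= (2 N / K) * sum r v ^ 2], where now [||v alpha|| <= K / N].
    Under Poissonian pair correlations [sum r v <= 3 K N] over such nonzero [v],
    and [r v <= N / (3 K)] for large [N], because all pairs with difference [v]
    lie at the same distance and the limiting distribution of the rescaled
    distances has no atom.  Hence [E <= 4 N ^ 3 / K], contradicting
    [E >= kappa N ^ 3] as soon as [K > 4 / kappa]. *)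

(** * Fractional parts and the distance to the nearest integer *)

Lemma fracpart_ge0 (R : realType) (x : R) : 0 <= fracpart x.
Proof. by rewrite /fracpart subr_ge0 floor_le. Qed.

Lemma fracpart_lt1 (R : realType) (x : R) : fracpart x < 1.
Proof. by have := floorD1_gt x; rewrite /fracpart intrD; lra. Qed.

Lemma fracpartDz (R : realType) (x : R) (n : int) :
  fracpart (x + n%:~R) = fracpart x.
Proof. by rewrite /fracpart floorDrz ?intr_int// intrKfloor intrD; lra. Qed.

Lemma dist_nearest_int_fracpartB (R : realType) (x y : R) :
  dist_nearest_int (fracpart x - fracpart y) = dist_nearest_int (x - y).
Proof.
rewrite /dist_nearest_int.
suff -> : fracpart (fracpart x - fracpart y) = fracpart (x - y) by [].
rewrite -(fracpartDz _ (x - y) (Num.floor y - Num.floor x)).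
by congr fracpart; rewrite /fracpart intrB; lra.
Qed.

Lemma dist_nearest_int_le_norm (R : realType) (x : R) :
  dist_nearest_int x <= `|x|.
Proof.
rewrite /dist_nearest_int ge_min /fracpart.
have [x0|x0] := leP 0 x.
  by rewrite ger0_norm// gerBl ler0z floor_ge0 x0.
rewrite ltr0_norm//; apply/orP; right.
have : (Num.floor x)%:~R <= (-1)%:~R :> R.
  by rewrite ler_int -ltzD1 addNr floor_lt0.
by rewrite intrN; lra.
Qed.

Lemma truncn_eq_dist_le1 (R : realType) (x y : R) : 0 <= x -> 0 <= y ->
  Num.truncn x = Num.truncn y -> `|x - y| <= 1.
Proof.
move=> x0 y0 xy.
have /andP[x1 x2] := truncn_itv x0; have /andP[y1 y2] := truncn_itv y0.
by rewrite xy -natr1 in x1 x2; rewrite -natr1 in y2; rewrite ler_norml; lra.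
Qed.

(** * Cauchy-Schwarz and the additive energy *)

Local Open Scope nat_scope.

(** Sum [2 * n i * n j <= n i ^ 2 + n j ^ 2] over all ordered pairs. *)
Lemma sum_nat_sqr_le (I : finType) (n : I -> nat) :
  (\sum_i n i) * (\sum_i n i) <= #|I| * \sum_i n i * n i.
Proof.
rewrite -(leq_pmul2l (ltn0Sn 1)).
have -> : 2 * (#|I| * \sum_i n i * n i) =
    \sum_i \sum_j (n i * n i + n j * n j).
  under [RHS]eq_bigr do rewrite big_split/= sum_nat_const.
  by rewrite big_split/= -big_distrr sum_nat_const/= mul2n addnn.
rewrite big_distrlr/= big_distrr/=; apply: leq_sum => i _.
rewrite big_distrr/=; apply: leq_sum => j _.
by rewrite !mulnn; exact: (nat_Cauchy _ _).1.
Qed.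

(** The map [h] cuts each fibre of [g] into at most [#|C|] cells; Cauchy-Schwarz bounds the squared
    size of the fibre by [#|C|] times the sum of the squared cell sizes. *)
Lemma count_eq_pairs_le (T C : finType) (D : eqType) (g : T -> D) (h : T -> C) :
  \sum_p \sum_q (g p == g q : nat) <=
  #|C| * \sum_p \sum_q ((g p == g q) && (h p == h q) : nat).
Proof.
pose s := undup (codom g).
have gs p : g p \in s by rewrite mem_undup codom_f.
have split_class p q : (g p == g q : nat) =
    \sum_(w <- s) (g p == w : nat) * (g q == w : nat).
  rewrite (bigD1_seq (g p))//= ?undup_uniq// eqxx mul1n eq_sym big1 ?addn0//.
  by move=> w wp; rewrite eq_sym (negbTE wp).
have lhsE : \sum_p \sum_q (g p == g q : nat) =
    \sum_(w <- s) (\sum_p (g p == w : nat)) * (\sum_p (g p == w : nat)).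
  under eq_bigr do under eq_bigr do rewrite split_class.
  under eq_bigr do rewrite exchange_big/=.
  by rewrite exchange_big/=; apply: eq_bigr => w _; rewrite big_distrlr.
have split_bin w : \sum_p (g p == w : nat) =
    \sum_c \sum_p ((g p == w) && (h p == c) : nat).
  rewrite exchange_big/=; apply: eq_bigr => p _.
  rewrite (bigD1 (h p))//= eqxx andbT big1 ?addn0// => c.
  by rewrite eq_sym => /negbTE ->; rewrite andbF.
have rhsE : \sum_p \sum_q ((g p == g q) && (h p == h q) : nat) =
    \sum_(w <- s) \sum_c (\sum_p ((g p == w) && (h p == c) : nat)) *
                         (\sum_p ((g p == w) && (h p == c) : nat)).
  have E p q : ((g p == g q) && (h p == h q) : nat) =
      \sum_(w <- s) \sum_c ((g p == w) && (h p == c) : nat) *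
                           ((g q == w) && (h q == c) : nat).
    rewrite -mulnb split_class big_distrl/=; apply: eq_bigr => w _.
    rewrite (bigD1 (h p))//= eqxx andbT big1 ?addn0 => [|c].
      by rewrite -mulnb mulnA (eq_sym (h p)).
    by rewrite eq_sym => /negbTE ->; rewrite andbF.
  under eq_bigr do under eq_bigr do rewrite E.
  under eq_bigr do rewrite exchange_big/=.
  rewrite exchange_big/=; apply: eq_bigr => w _.
  under eq_bigr do rewrite exchange_big/=.
  by rewrite exchange_big/=; apply: eq_bigr => c _; rewrite big_distrlr.
rewrite lhsE rhsE big_distrr/=; apply: leq_sum => w _.
rewrite split_bin; exact: sum_nat_sqr_le.
Qed.

(** Pairs with [V p.1 - V p.2 = V i - V l], written additively because subtraction on [nat]
    truncates. *)
Definition same_difference (T : finType) (V : T -> nat) (i l : T) : {set T * T} :=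
  [set p | V i + V p.2 == V p.1 + V l]%SET.

Definition indexed_energy (T : finType) (V : T -> nat) : nat :=
  \sum_i \sum_j \sum_k \sum_l (V i + V j == V k + V l : nat).

(** Pairs [(i, k)] and [(l, j)] of equal difference are binned by their first points. Once [i] and
    [l] share a bin, regrouping by [(i, l)] turns the condition into [V k - V j = V i - V l]. *)
Lemma indexed_energy_le (T C : finType) (V : T -> nat) (h : T -> C) :
  indexed_energy T V <=
  #|C| * \sum_(p : T * T | h p.1 == h p.2) #|same_difference T V p.1 p.2|.
Proof.
pose g (p : T * T) : int := ((V p.1)%:Z - (V p.2)%:Z)%R.
have gE i k l j : (g (i, k) == g (l, j)) = (V i + V j == V k + V l).
  by rewrite /g/=; apply/eqP/eqP; lia.
have -> : indexed_energy T V = \sum_p \sum_q (g p == g q : nat).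
  rewrite -(pair_bigA _ (fun i k => \sum_q (g (i, k) == g q : nat)))/=.
  apply: eq_bigr => i _; rewrite exchange_big/=; apply: eq_bigr => k _.
  rewrite -(pair_bigA _ (fun l j => (g (i, k) == g (l, j) : nat)))/=.
  rewrite exchange_big/=; apply: eq_bigr => j _; apply: eq_bigr => l _.
  by rewrite gE.
apply: (leq_trans (count_eq_pairs_le _ _ _ g (fun p => h p.1))).
rewrite leq_mul2l; apply/orP; right.
rewrite (eq_bigr (fun p => \sum_q ((g (p.1, p.2) == g q) && (h p.1 == h q.1) : nat)));
  last by case.
rewrite -(pair_bigA _ (fun i k => \sum_q ((g (i, k) == g q) && (h i == h q.1) : nat)))/=.
rewrite [leqRHS]big_mkcond/=.
rewrite -(pair_bigA _ (fun i l => if h i == h l then #|same_difference T V i l| else 0))/=.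
apply: leq_sum => i _.
under eq_bigr => k _ do
  rewrite -(pair_bigA _ (fun l j => ((g (i, k) == g (l, j)) && (h i == h l) : nat)))/=.
rewrite exchange_big/=; apply: leq_sum => l _.
case: ifPn => _; last by rewrite big1// => k _; rewrite big1// => j _; rewrite andbF.
rewrite -sum1_card [leqRHS]big_mkcond/=.
rewrite [leqRHS](eq_bigr (fun p => (V i + V p.2 == V p.1 + V l : nat))); last first.
  by move=> p _; rewrite inE; case: (_ == _).
rewrite -(pair_bigA _ (fun k j => (V i + V j == V k + V l : nat)))/=.
by apply: leq_sum => k _; apply: leq_sum => j _; rewrite gE andbT.
Qed.

(** The difference is zero here, so a pair is determined by its first entry. *)
Lemma card_same_difference_diag (T : finType) (V : T -> nat) (i : T) :
  injective V -> #|same_difference T V i i| <= #|T|.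
Proof.
move=> Vinj; rewrite -(@card_in_imset _ _ fst); last first.
  move=> [k j] [k' j']; rewrite !inE/= => /eqP e /eqP e' kk'.
  by rewrite kk' in e *; congr pair; apply: Vinj; lia.
exact: max_card.
Qed.

Lemma additive_energyE (a : nat -> nat) (N : nat) :
  (forall m n, 1 <= m -> 1 <= n -> a m = a n -> m = n) ->
  additive_energy (A_N a N) = indexed_energy 'I_N (fun i => a i.+1).
Proof.
move=> inj_a; rewrite /additive_energy undup_id; last first.
  rewrite map_inj_in_uniq ?iota_uniq// => m n.
  by rewrite !mem_index_iota => /andP[m1 _] /andP[n1 _]; exact: inj_a.
have sumE (F : nat -> nat) :
    \sum_(b <- A_N a N) F b = \sum_(i < N) F (a i.+1).
  by rewrite big_map big_add1 big_mkord.
rewrite sumE; apply: eq_bigr => i _; rewrite sumE; apply: eq_bigr => j _.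
by rewrite sumE; apply: eq_bigr => k _; rewrite sumE.
Qed.

(** * Pair correlations and the absence of atoms *)

Local Open Scope ring_scope.

Definition close_pairs (R : realType) (x : nat -> R) (s : R) (N : nat) :
    {set 'I_N * 'I_N} :=
  [set p : 'I_N * 'I_N | (p.1 != p.2) &&
    (dist_nearest_int (x p.1.+1 - x p.2.+1) <= s / N%:R)]%SET.

Lemma R2E (R : realType) (x : nat -> R) (s : R) (N : nat) :
  R2 x s N = N%:R^-1 * #|close_pairs R x s N|%:R.
Proof.
(* [lift ord0] skips the index 0, which [R2] excludes. *)
pose f (p : 'I_N * 'I_N) : 'I_N.+1 * 'I_N.+1 := (lift ord0 p.1, lift ord0 p.2).
have f_inj : injective f.
  move=> [i j] [i' j'] e; congr pair; apply: (@lift_inj _ ord0).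
    exact: (congr1 fst e).
  exact: (congr1 snd e).
rewrite /R2 -(card_imset _ f_inj); congr (_ * _%:R); apply: eq_card => -[i j].
apply/idP/imsetP => [|[[k l]]].
  rewrite in_setE => /and4P[]/=; case: (unliftP ord0 i) => [k ->|-> //] _.
  case: (unliftP ord0 j) => [l ->|-> //] _; rewrite (inj_eq (@lift_inj _ ord0)) => kl d.
  by exists (k, l); rewrite // inE/= kl.
rewrite inE/= => /andP[kl d] [-> ->].
by rewrite in_setE; apply/and4P; split; rewrite ?(inj_eq (@lift_inj _ ord0)).
Qed.

Lemma eventually_forall_lt (P : nat -> nat -> Prop) (L : nat) :
  (forall m, exists N0, forall N, (N0 <= N)%N -> P m N) ->
  exists N0, forall N, (N0 <= N)%N -> forall m, (m < L)%N -> P m N.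
Proof.
move=> evP; elim: L => [|L [N0 IH]]; first by exists 0%N.
have [N1 PL] := evP L; exists (maxn N0 N1) => N.
rewrite geq_max => /andP[N0N N1N] m; rewrite ltnS leq_eqVlt => /predU1P[->|mL].
  exact: PL.
exact: IH.
Qed.

Lemma poissonian_R2_near (R : realType) (x : nat -> R) (s e : R) :
  poissonian_pair_correlations x -> 0 < s -> 0 < e ->
  exists N0, forall N, (N0 <= N)%N -> `|2 * s - R2 x s N| <= e.
Proof.
move=> ppc s0 e0; have /cvgrPdist_le/(_ e e0)[N0 _ H] := ppc s s0.
by exists N0 => N N0N; exact: H.
Qed.

(* The rescaled pair distances converge to Lebesgue measure, which has no atom. *)
Lemma poissonian_no_atom (R : realType) (x : nat -> R) (s c : R) :
  poissonian_pair_correlations x -> 0 < c ->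
  exists N0, forall N, (N0 <= N)%N -> forall (t : R) (A : {set 'I_N * 'I_N}),
    A \subset close_pairs R x s N ->
    (forall p, p \in A -> dist_nearest_int (x p.1.+1 - x p.2.+1) = t) ->
    #|A|%:R <= c * N%:R.
Proof.
(* A grid cell of width [d] has limiting mass [2 * d], and each of its two ends costs an error [d]:
   in total [4 * d = c]. *)
move=> ppc c0; pose d := c / 4; have d0 : 0 < d by rewrite divr_gt0.
(* Since [L * d > s], finitely many grid radii cover all rescaled distances up to [s]. *)
pose L := (Num.truncn (s / d)).+1.
have [N0 HN0] := eventually_forall_lt
  (fun m N => `|2 * (m.+1%:R * d) - R2 x (m.+1%:R * d) N| <= d) L.+1
  (fun m => poissonian_R2_near R x (m.+1%:R * d) d ppc
     (mulr_gt0 (ltr0Sn R m) d0) d0).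
exists N0.+1 => N N0N t A Asub At.
have Npos : 0 < N%:R :> R by rewrite ltr0n; exact: leq_trans N0N.
have [->|[p0 p0A]] := set_0Vmem A; first by rewrite cards0 mulr_ge0// ltW.
have tL : t <= L.+1%:R * d / N%:R.
  have := fintype.subsetP Asub _ p0A; rewrite inE At// => /andP[_ /le_trans-> //].
  rewrite ler_pM2r ?invr_gt0// -ler_pdivrMr//.
  by apply: (le_trans (ltW (truncnS_gt (s / d)))); rewrite ler_nat.
have [m tm mmin] := ex_minnP (ex_intro (fun m : nat => t <= m.+1%:R * d / N%:R) L tL).
have mL : (m <= L)%N := mmin _ tL.
have near_m k : (k <= L)%N ->
    `|2 * (k.+1%:R * d) - R2 x (k.+1%:R * d) N| <= d.
  by move=> kL; apply: HN0 => //; exact: ltnW.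
have Aclose : A \subset close_pairs R x (m.+1%:R * d) N.
  apply/fintype.subsetP => p pA; have := fintype.subsetP Asub _ pA.
  by rewrite !inE => /andP[-> _]; rewrite At.
have cardR2 (r : R) : #|close_pairs R x r N|%:R = R2 x r N * N%:R.
  by rewrite R2E mulrC mulVKf// gt_eqF.
have cd : c = 4 * d by rewrite /d; lra.
have {}mm := near_m m mL; move: mm; rewrite ler_norml => /andP[m1 m2].
(* In the first cell there is no smaller radius to subtract, and [R2 <= 3 * d] suffices. *)
case: m => [|m] in tm mmin mL Aclose m1 m2 *.
  apply: (@le_trans _ _ #|close_pairs R x (1 * d) N|%:R).
    by rewrite ler_nat subset_leq_card.
  by rewrite cardR2 ler_pM2r//; lra.
(* Minimality puts [t] beyond the previous radius, so [A] lies in the difference of two consecutive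
   sets of close pairs. *)
have Adisj : [disjoint A & close_pairs R x (m.+1%:R * d) N].
  apply/pred0P => p /=; apply/negP => /andP[pA]; rewrite inE At// => /andP[_ /mmin].
  by rewrite ltnn.
have : (#|A| + #|close_pairs R x (m.+1%:R * d) N| <=
        #|close_pairs R x (m.+2%:R * d) N|)%N.
  have [_] := leq_card_setU A (close_pairs R x (m.+1%:R * d) N).
  rewrite Adisj => /eqP <-; apply: subset_leq_card.
  rewrite finset.subUset Aclose/=; apply/fintype.subsetP => p.
  rewrite !inE => /andP[-> /le_trans]; apply.
  by rewrite ler_pM2r ?invr_gt0// ler_pM2r// ler_nat.
rewrite -(ler_nat R) natrD !cardR2 => cardA.
have := near_m m (ltnW mL); rewrite ler_norml => /andP[m3 m4].
have : #|A|%:R <= (R2 x (m.+2%:R * d) N - R2 x (m.+1%:R * d) N) * N%:R by lra.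
move=> /le_trans; apply; rewrite ler_pM2r// cd.
have e : m.+2%:R * d = m.+1%:R * d + d by rewrite -natr1 mulrDl mul1r.
by move: m1 m4; set u := R2 _ _ _; set v := R2 _ _ _; rewrite e; lra.
Qed.

(** * From the energy to close pairs on the circle *)

Lemma dist_nearest_int_same_difference (R : realType) (alpha : R)
    (i j k l : nat) : (i + l = k + j)%N ->
  dist_nearest_int (fracpart (i%:R * alpha) - fracpart (j%:R * alpha)) =
  dist_nearest_int (fracpart (k%:R * alpha) - fracpart (l%:R * alpha)).
Proof.
move=> /(congr1 (fun n => n%:R : R)); rewrite !natrD => e.
(* Fractional parts alter a difference only by an integer, and [i - j = k - l] in [R]. *)
rewrite !dist_nearest_int_fracpartB -!mulrBl; congr (dist_nearest_int (_ * _)).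
lra.
Qed.

(* The terms [N ^ 2] and [#|close_pairs|] account for the diagonal and the
   off-diagonal pairs lying in a common arc of length [1 / M.+1]. *)
Lemma indexed_energy_le_close_pairs (R : realType) (V : nat -> nat)
    (x : nat -> R) (N M : nat) (s b : R) :
  (forall m n, (1 <= m)%N -> (1 <= n)%N -> V m = V n -> m = n) ->
  (forall n, 0 <= x n < 1) -> M.+1%:R^-1 <= s / N%:R ->
  (forall p, p \in close_pairs R x s N ->
     #|same_difference 'I_N (fun i => V i.+1) p.1 p.2|%:R <= b) ->
  (indexed_energy 'I_N (fun i => V i.+1))%:R <=
    M.+1%:R * (N%:R ^+ 2 + #|close_pairs R x s N|%:R * b).
Proof.
move=> inj_V x01 Ms rb; set r := same_difference _ _ in rb *.
have inj_V' : injective (fun i : 'I_N => V i.+1).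
  by move=> i j /inj_V-/(_ isT isT)[] /val_inj.
have bin_lt n : (Num.truncn (M.+1%:R * x n) < M.+1)%N.
  have /andP[xn0 xn1] := x01 n.
  by rewrite truncn_lt_nat ?mulr_ge0// gtr_pMr// ltr0n.
pose h (i : 'I_N) := Ordinal (bin_lt i.+1).
(* Two points of one arc differ by at most [1 / M.+1] already as real numbers. *)
have same_bin (p : 'I_N * 'I_N) : h p.1 == h p.2 -> p.1 != p.2 ->
    p \in close_pairs R x s N.
  move=> /eqP/(congr1 val)/= hp p12; rewrite inE p12/=.
  have /andP[x1 _] := x01 p.1.+1; have /andP[x2 _] := x01 p.2.+1.
  apply: (le_trans (dist_nearest_int_le_norm _ _)); apply: le_trans Ms.
  rewrite -[leRHS]mul1r ler_pdivlMr ?ltr0n// -[X in _ * X]ger0_norm ?ler0n//.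
  rewrite -normrM mulrBl ![x _ * _]mulrC.
  by apply: truncn_eq_dist_le1; rewrite ?mulr_ge0.
have := indexed_energy_le 'I_N 'I_M.+1 (fun i => V i.+1) h.
rewrite card_ord -(ler_nat R) natrM => /le_trans; apply.
rewrite ler_pM2l ?ltr0n//.
rewrite natr_sum (bigID (fun p : 'I_N * 'I_N => p.1 == p.2))/=.
apply: lerD.
  apply: (@le_trans _ _ (\sum_(p : 'I_N * 'I_N | p.1 == p.2) N%:R)).
    rewrite big_mkcond [leRHS]big_mkcond/=; apply: ler_sum => -[i j] _ /=.
    have [<-|] := eqVneq i j; last by rewrite andbF.
    by rewrite eqxx ler_nat -[leqRHS]card_ord; exact: card_same_difference_diag.
  rewrite big_mkcond/= -(pair_bigA _ (fun i j => if i == j then N%:R else 0))/=.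
  rewrite (eq_bigr (fun=> N%:R)) => [|i _]; last first.
    by rewrite -big_mkcond (big_pred1 i)// => j; rewrite eq_sym.
  by rewrite sumr_const card_ord expr2 mulr_natl.
apply: (@le_trans _ _ (\sum_(p in close_pairs R x s N) b)); last first.
  by rewrite sumr_const mulr_natl.
apply: (@le_trans _ _ (\sum_(p in close_pairs R x s N) #|r p.1 p.2|%:R)).
  rewrite big_mkcond [leRHS]big_mkcond/=; apply: ler_sum => p _.
  case: ifPn => [/andP[p1 p2]|_]; first by rewrite same_bin.
  by case: ifP => _ //; rewrite ler0n.
by apply: ler_sum => p; exact: rb.
Qed.

(** * Choice of parameters and the contradiction *)

Theorem theorem1 (R : realType) (a : nat -> nat)
  (hpos : forall n : nat, (1 <= n)%N -> (0 < a n)%N)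
  (hdist : forall m n : nat, (1 <= m)%N -> (1 <= n)%N -> a m = a n -> m = n)
  (hE : energy_Omega_cube R a) :
  forall alpha : R,
    ~ poissonian_pair_correlations (fun n : nat => fracpart ((a n)%:R * alpha)).
Proof.
move=> alpha ppc; have [kappa [k0 hE']] := hE.
set x := (fun n : nat => fracpart ((a n)%:R * alpha)) in ppc.
pose K := (Num.truncn (4 / kappa)).+1.
have K0 : 0 < K%:R :> R by rewrite ltr0n.
have kK : 4 < kappa * K%:R by rewrite mulrC -ltr_pdivrMr// truncnS_gt.
(* With at most [3 * K * N] close pairs, this atom bound keeps their contribution below [N ^ 2], the
   size of the diagonal term. *)
have c0 : 0 < (3 * K%:R)^-1 :> R by rewrite invr_gt0 mulr_gt0.
have [N0 no_atom] := poissonian_no_atom R x K%:R _ ppc c0.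
(* A tolerance [K] around the limit [2 * K] gives the factor [3 * K]. *)
have [N1 nearK] := poissonian_R2_near R x K%:R K%:R ppc K0 K0.
have [N [leN EN]] := hE' (maxn K (maxn N0 N1)).
have [KN N0N N1N] : [/\ (K <= N)%N, (N0 <= N)%N & (N1 <= N)%N].
  by move: leN; rewrite !geq_max => /and3P[].
have Npos : 0 < N%:R :> R by rewrite ltr0n; exact: leq_trans KN.
have Pcard : #|close_pairs R x K%:R N|%:R <= 3 * K%:R * N%:R :> R.
  have := nearK N N1N; rewrite ler_norml R2E => /andP[PN _].
  by rewrite -ler_pdivrMr// mulrC; lra.
have x01 n : 0 <= x n < 1 by rewrite fracpart_ge0 fracpart_lt1.
(* The successor rounds the number of arcs above [N / K], so an arc is no longer than [K / N]. *)
have NK : (N %/ K).+1%:R^-1 <= K%:R / N%:R :> R.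
  rewrite -[leRHS]invrK lef_pV2 ?posrE ?invr_gt0 ?divr_gt0// invf_div.
  by rewrite ler_pdivrMr// -natrM ler_nat ltnW// ltn_ceil.
have sub_atom p : p \in close_pairs R x K%:R N ->
    #|same_difference 'I_N (fun i => a i.+1) p.1 p.2|%:R
      <= (3 * K%:R)^-1 * N%:R :> R.
  (* Every pair with the difference of [p] has the same distance as [p], and is off the diagonal
     because [p] is and [a] is injective. *)
  move=> pP; apply: (no_atom N N0N (dist_nearest_int (x p.1.+1 - x p.2.+1))).
    apply/fintype.subsetP => q; rewrite !inE => /eqP e.
    move: pP; rewrite inE => /andP[p12 dp]; apply/andP; split.
      apply: contraNneq p12 => q12; rewrite -val_eqE/=; apply/eqP.
      by apply/eq_add_S/hdist => //; move: e; rewrite q12/=; lia.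
    by rewrite /x -(dist_nearest_int_same_difference _ _ _ _ _ _ e).
  move=> q; rewrite inE => /eqP e.
  by rewrite /x (dist_nearest_int_same_difference _ _ _ _ _ _ e).
have := indexed_energy_le_close_pairs R a x N (N %/ K) _ _ hdist x01 NK sub_atom.
rewrite -additive_energyE// => /(le_trans EN).
apply/negP; rewrite -ltNge.
(* Here [K <= N] absorbs the extra arc. *)
have M2 : (N %/ K).+1%:R <= 2 * N%:R / K%:R :> R.
  rewrite ler_pdivlMr// -!natrM ler_nat; have := leq_trunc_div N K; lia.
have PN : #|close_pairs R x K%:R N|%:R * ((3 * K%:R)^-1 * N%:R) <= N%:R ^+ 2 :> R.
  by rewrite mulrA expr2 ler_pM2r// ler_pdivrMr ?mulr_gt0// [leRHS]mulrC.
apply: (@le_lt_trans _ _ (2 * N%:R / K%:R * (2 * N%:R ^+ 2))).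
  by apply: ler_pM => //; lra.
rewrite -(ltr_pM2r K0).
have -> : 2 * N%:R / K%:R * (2 * N%:R ^+ 2) * K%:R = 4 * N%:R ^+ 3 :> R.
  by field; rewrite gt_eqF.
by rewrite mulrAC ltr_pM2r// exprn_gt0.
Qed.
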